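(* Let $G_1=([n],E_1)$ and $G_2=([n],E_2)$ be simple undirected graphs on $n$ vertices each, and let $cp\vartheta$ denote the optimal value of the completely positive program CP-LT associated with $(G_1,G_2)$. If $G_1$ and $G_2$ are isomorphic, then $cp\vartheta = n$. If $G_1$ and $G_2$ are not isomorphic, then $cp\vartheta < n-\frac{1}{4n^4}$. In particular, this gives a test for graph isomorphism: $G_1$ and $G_2$ are isomorphic if and only if $cp\vartheta=n$.
   Context: $[n]=\{1,\dots,n\}$. Edges are unordered pairs of distinct vertices; $(i,k)\in E$ means that $\{i,k\}$ is an edge (so $(i,i)\notin E$). $G_1$ and $G_2$ are isomorphic if there is a bijection $\sigma:[n]\to[n]$ with $(\sigma(x),\sigma(y))\in E_2$ if and only if $(x,y)\in E_1$. A real symmetric $m\times m$ matrix $M$ is completely positive (CP) if $M=QQ^T$ for some real $m\times k$ matrix $Q$ with all entries non-negative. The program CP-LT for $(G_1,G_2)$: the variable is a real symmetric $(n^2+1)\times(n^2+1)$ matrix $Y$ with rows and columns indexed by $\{ij \mid i,j\in[n]\}\cup\{\omega\}$. Maximize $\sum_{i,j\in[n]}Y_{ij,ij}$ subject to: $Y$ is completely positive; $Y_{\omega,\omega}=1$; $Y_{ij,\omega}=Y_{ij,ij}$ for all $i,j\in[n]$; $Y_{ij,ik}=0$ for all $i,j,k\in[n]$ with $j\neq k$; $Y_{ji,ki}=0$ for all $i,j,k\in[n]$ with $j\ne k$; $Y_{ij,kl}=0$ whenever $(i,k)\in E_1$ and $(j,l)\notin E_2$; $Y_{ij,kl}=0$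 whenever $(i,k)\notin E_1$ and $(j,l)\in E_2$. *)

(* Defs.v *)
From mathcomp Require Import all_boot all_order all_fingroup all_algebra.
From mathcomp Require Import classical_sets reals ereal.

Set Implicit Arguments.
Unset Strict Implicit.
Unset Printing Implicit Defensive.

Import Order.TTheory GRing.Theory Num.Theory.

Local Open Scope ring_scope.
Local Open Scope classical_set_scope.

(* A simple graph on [n] is an edge relation on 'I_n (vertices are numbered
   from 0) that is symmetric and irreflexive. *)
Definition simple_graph (n : nat) (E : rel 'I_n) : Prop :=
  symmetric E /\ irreflexive E.

Definition isomorphic (n : nat) (E1 E2 : rel 'I_n) : Prop :=
  exists sigma : 'S_n, forall x y, E2 (sigma x) (sigma y) = E1 x y.

Definition completely_positive (R : realType) (m : nat) (M : 'M[R]_m) : Prop :=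
  M^T = M /\
  exists (k : nat) (Q : 'M[R]_(m, k)),
    (forall i j, 0 <= Q i j) /\ M = Q *m Q^T.

(* The index set {ij | i, j in [n]} U {omega} is encoded as 'I_(n * n + 1):
   the pairs ij come first, through the bijection [mxvec_index] from pairs
   onto 'I_(n * n), and omega is the last index. *)
Definition pidx (n : nat) (i j : 'I_n) : 'I_(n * n + 1) :=
  lshift 1 (mxvec_index i j).

Definition omega (n : nat) : 'I_(n * n + 1) := rshift (n * n) ord0.

Record cplt_feasible (R : realType) (n : nat) (E1 E2 : rel 'I_n)
    (Y : 'M[R]_(n * n + 1)) : Prop := CpltFeasible {
  cplt_cp : completely_positive Y ;
  cplt_omega : Y (omega n) (omega n) = 1 ;
  cplt_diag : forall i j, Y (pidx i j) (omega n) = Y (pidx i j) (pidx i j) ;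
  cplt_row : forall i j k, j != k -> Y (pidx i j) (pidx i k) = 0 ;
  cplt_col : forall i j k, j != k -> Y (pidx j i) (pidx k i) = 0 ;
  cplt_edge : forall i j k l,
    E1 i k -> ~~ E2 j l -> Y (pidx i j) (pidx k l) = 0 ;
  cplt_nonedge : forall i j k l,
    ~~ E1 i k -> E2 j l -> Y (pidx i j) (pidx k l) = 0
}.

Definition cplt_objective (R : realType) (n : nat) (Y : 'M[R]_(n * n + 1)) : R :=
  \sum_(i < n) \sum_(j < n) Y (pidx i j) (pidx i j).

(* The optimal value is taken in the extended reals, so that no convention is
   needed for an infeasible or unbounded program. *)
Definition cptheta (R : realType) (n : nat) (E1 E2 : rel 'I_n) : \bar R :=
  ereal_sup [set (cplt_objective Y)%:E
            | Y in [set Y : 'M[R]_(n * n + 1) | cplt_feasible E1 E2 Y]].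

(* Main.v *)
(* Write a feasible Y as Q Q^T with Q non-negative.  By non-negativity every
   zero of Y forces, in each column of Q, one of the two corresponding entries
   to vanish, so the set of pairs ij supporting a column is a partial
   isomorphism from G1 to G2.  Since Y_{ij,ij} = Y_{ij,omega}, the objective is
   the sum of 2 Q_{ij,c} Q_{omega,c} - Q_{ij,c}^2 <= Q_{omega,c}^2 over the ij in
   the support of column c, so it is at most the largest size of such a support
   (as Y_{omega,omega} = 1).  That size is at most n, and at most n - 1 when the
   graphs are not isomorphic, which is stronger than the gap 1 / (4 n^4). *)
Require Import Defs.
From mathcomp Require Import all_boot all_order all_fingroup all_algebra.
From mathcomp Require Import lra.
From mathcomp Require Import boolp classical_sets reals ereal.

Import Order.TTheory GRing.Theory Num.Theory.

Local Open Scope ring_scope.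

(** A partial map is encoded by its graph, a set of pairs, since this is the form in which the
    support of a column arises. *)
Record partial_isomorphism {n : nat} (E1 E2 : rel 'I_n)
    (S : {set 'I_n * 'I_n}) : Prop := PartialIsomorphism {
  piso_fun : {in S &, forall p q, p.1 = q.1 -> p.2 = q.2} ;
  piso_inj : {in S &, forall p q, p.2 = q.2 -> p.1 = q.1} ;
  piso_edge : {in S &, forall p q, E2 p.2 q.2 = E1 p.1 q.1}
}.

Lemma card_partial_isomorphism_dom {n : nat} {E1 E2 : rel 'I_n}
    {S : {set 'I_n * 'I_n}} :
  partial_isomorphism E1 E2 S -> #|[set p.1 | p in S]| = #|S|.
Proof.
case=> Sfun _ _; apply: card_in_imset => p q pS qS pq.
exact: injective_projections pq (Sfun _ _ pS qS pq).
Qed.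

Lemma card_partial_isomorphism {n : nat} {E1 E2 : rel 'I_n}
    {S : {set 'I_n * 'I_n}} :
  partial_isomorphism E1 E2 S -> (#|S| <= n)%N.
Proof.
move=> /card_partial_isomorphism_dom <-.
by rewrite -[X in (_ <= X)%N]card_ord max_card.
Qed.

(** By cardinality the domain of [S] is all of $[n]$, so [S] is the graph of an injective self-map
    of a finite set, hence of a permutation. *)
Lemma full_partial_isomorphism {n : nat} {E1 E2 : rel 'I_n}
    {S : {set 'I_n * 'I_n}} :
  partial_isomorphism E1 E2 S -> #|S| = n -> isomorphic E1 E2.
Proof.
move=> isoS cardS; have [_ Sinj Sedge] := isoS.
have domS : [set p.1 | p in S] = [set: 'I_n].
  apply/eqP; rewrite eqEcard finset.subsetT cardsT card_ord.
  by rewrite (card_partial_isomorphism_dom isoS) cardS leqnn.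
have exS i : exists j, (i, j) \in S.
  have : i \in [set p.1 | p in S] by rewrite domS finset.inE.
  by case/imsetP=> -[k j] kjS ->; exists j.
pose f i := xchoose (exS i).
have fS i : (i, f i) \in S := xchooseP (exS i).
have f_inj : injective f by move=> i k /(Sinj _ _ (fS i) (fS k)).
by exists (perm f_inj) => i k; rewrite !permE (Sedge _ _ (fS i) (fS k)).
Qed.

Lemma card_partial_isomorphism_lt {n : nat} {E1 E2 : rel 'I_n}
    {S : {set 'I_n * 'I_n}} :
  ~ isomorphic E1 E2 -> partial_isomorphism E1 E2 S -> (#|S| < n)%N.
Proof.
move=> nisoE isoS; rewrite ltn_neqAle (card_partial_isomorphism isoS) andbT.
by apply/eqP => /(full_partial_isomorphism isoS).
Qed.

Lemma gram_entry {R : pzSemiRingType} {m k : nat} (Q : 'M[R]_(m, k)) i j :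
  (Q *m Q^T) i j = \sum_c Q i c * Q j c.
Proof. by rewrite mxE; apply: eq_bigr => c _; rewrite mxE. Qed.

(** A sum of non-negative terms vanishes only if every term does. *)
Lemma gram_eq0 {R : numDomainType} {m k : nat} {Q : 'M[R]_(m, k)} {i j} :
  (forall i j, 0 <= Q i j) -> (Q *m Q^T) i j = 0 ->
  forall c, Q i c * Q j c = 0.
Proof.
rewrite gram_entry => Q_ge0 /eqP.
rewrite psumr_eq0 => [/allP Q0 c|c _]; last exact: mulr_ge0.
by apply/eqP/Q0; rewrite mem_index_enum.
Qed.

Definition column_support {R : realType} {n k : nat}
    (Q : 'M[R]_(n * n + 1, k)) (c : 'I_k) : {set 'I_n * 'I_n} :=
  [set p | Q (pidx p.1 p.2) c != 0].

Lemma column_support_partial_isomorphism {R : realType} {n k : nat}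
    {E1 E2 : rel 'I_n} {Q : 'M[R]_(n * n + 1, k)} :
  (forall i j, 0 <= Q i j) -> cplt_feasible E1 E2 (Q *m Q^T) ->
  forall c, partial_isomorphism E1 E2 (column_support Q c).
Proof.
move=> Q_ge0 [_ _ _ Yrow Ycol Yedge Ynonedge] c.
(* Two pairs supported by the same column have a non-zero entry in the Gram matrix, so no zero
   constraint can apply to them. *)
have nz p q : p \in column_support Q c -> q \in column_support Q c ->
    (Q *m Q^T) (pidx p.1 p.2) (pidx q.1 q.2) <> 0.
  rewrite !finset.inE => Qp Qq /(gram_eq0 Q_ge0)/(_ c)/eqP.
  by rewrite mulf_eq0 (negbTE Qp) (negbTE Qq).
split=> -[i j] [k' l] pS qS /=; have /= Y0 := nz _ _ pS qS.
- move=> ik; subst k'; apply/eqP/negPn/negP => jl.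
  exact: Y0 (Yrow _ _ _ jl).
- move=> jl; subst l; apply/eqP/negPn/negP => ik.
  exact: Y0 (Ycol _ _ _ ik).
- case e1: (E1 i k'); case e2: (E2 j l) => //; case: Y0.
  + by apply: Yedge; rewrite ?e1 ?e2.
  + by apply: Ynonedge; rewrite ?e1 ?e2.
Qed.

Lemma cplt_objective_le {R : realType} {n : nat} {E1 E2 : rel 'I_n} {m : nat}
    {Y : 'M[R]_(n * n + 1)} :
  (forall S, partial_isomorphism E1 E2 S -> (#|S| <= m)%N) ->
  cplt_feasible E1 E2 Y -> cplt_objective Y <= m%:R.
Proof.
move=> le_m feasY; have [[_ [k [Q [Q_ge0 YE]]]] Yomega Ydiag _ _ _ _] := feasY.
subst Y; have isoS := column_support_partial_isomorphism Q_ge0 feasY.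
set a := Q (omega n); set b := fun p : 'I_n * 'I_n => Q (pidx p.1 p.2).
have objE : cplt_objective (Q *m Q^T) = \sum_p \sum_c b p c * b p c.
  rewrite /cplt_objective pair_big; apply: eq_bigr => p _.
  by rewrite gram_entry.
have objE' : cplt_objective (Q *m Q^T) = \sum_p \sum_c b p c * a c.
  rewrite /cplt_objective pair_big; apply: eq_bigr => p _.
  by rewrite -Ydiag gram_entry.
(* Twice the expression through [omega] minus the diagonal one, regrouped by columns. *)
have -> : cplt_objective (Q *m Q^T) =
    \sum_c \sum_p (b p c * a c + b p c * a c - b p c * b p c).
  rewrite exchange_big /=; under eq_bigr do rewrite sumrB big_split.
  by rewrite sumrB big_split /= -objE -objE' addrK.
(* The entry at [omega] is 1, so the squares [a c * a c] are weights of total 1 that distribute the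
   bound over the columns. *)
have <- : \sum_c m%:R * (a c * a c) = m%:R.
  by rewrite -mulr_sumr -gram_entry Yomega mulr1.
apply: ler_sum => c _.
rewrite (bigID [in column_support Q c]) /= [X in _ + X]big1 ?addr0; last first.
  by move=> p; rewrite finset.inE negbK /b => /eqP->; rewrite !mul0r subr0 addr0.
apply: (@le_trans _ _ (\sum_(p in column_support Q c) a c * a c)).
  (* $2ab - b^2 \le a^2$ is $(a-b)^2 \ge 0$. *)
  by apply: ler_sum => p _; have := sqr_ge0 (a c - b p c); nra.
rewrite sumr_const -[leLHS]mulr_natl ler_wpM2r ?mulr_ge0 ?Q_ge0 //.
by rewrite ler_nat le_m.
Qed.

Lemma cptheta_le {R : realType} {n : nat} {E1 E2 : rel 'I_n} {m : nat} :
  (forall S, partial_isomorphism E1 E2 S -> (#|S| <= m)%N) ->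
  (cptheta R E1 E2 <= m%:R%:E)%E.
Proof.
move=> le_m; apply: ge_ereal_sup => _ [Y feasY <-].
by rewrite lee_fin (cplt_objective_le le_m feasY).
Qed.

(** Indicator vector of the graph of [sigma], extended by 1 at [omega]; for an isomorphism its
    rank-one Gram matrix is an optimal solution. *)
Definition perm_vector (R : realType) {n : nat} (sigma : 'S_n) :
    'cV[R]_(n * n + 1) :=
  col_mx (mxvec (perm_mx sigma))^T (const_mx 1).

Lemma perm_vector_pidx {R : realType} {n : nat} (sigma : 'S_n) i j c :
  perm_vector R sigma (pidx i j) c = (sigma i == j)%:R.
Proof. by rewrite col_mxEu mxE ord1 mxvecE !mxE. Qed.

Lemma perm_vector_omega {R : realType} {n : nat} (sigma : 'S_n) c :
  perm_vector R sigma (omega n) c = 1.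
Proof. by rewrite col_mxEd mxE. Qed.

Lemma perm_vector_feasible {R : realType} {n : nat} {E1 E2 : rel 'I_n}
    {sigma : 'S_n} :
  (forall x y, E2 (sigma x) (sigma y) = E1 x y) ->
  cplt_feasible E1 E2 (perm_vector R sigma *m (perm_vector R sigma)^T).
Proof.
move=> isoE; set v := perm_vector R sigma.
have YE i j k l : (v *m v^T) (pidx i j) (pidx k l) =
    ((sigma i == j) && (sigma k == l))%:R.
  by rewrite gram_entry big_ord1 !perm_vector_pidx -natrM mulnb.
have Y0 i j k l : ~ (sigma i = j /\ sigma k = l) ->
    (v *m v^T) (pidx i j) (pidx k l) = 0.
  rewrite YE => nij; case: eqP => // ij; case: eqP => // kl.
  by case: nij.
split.
- split; first by rewrite trmx_mul trmxK.
  exists 1%N, v; split=> // i j.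
  rewrite [j]ord1 mxE; case: split => l; rewrite !mxE //.
  by case/mxvec_indexP: l => i' j'; rewrite mxvecE !mxE ler0n.
- by rewrite gram_entry big_ord1 !perm_vector_omega mulr1.
- move=> i j; rewrite YE gram_entry big_ord1 perm_vector_pidx.
  by rewrite perm_vector_omega mulr1 andbb.
- by move=> i j k /eqP jk; apply: Y0 => -[ij ik]; apply: jk; rewrite -ij.
- move=> i j k /eqP jk; apply: Y0 => -[ji ki]; apply: jk.
  by apply: (@perm_inj _ sigma); rewrite ji.
- move=> i j k l e1 e2; apply: Y0 => -[ij kl].
  by move: e2; rewrite -ij -kl isoE e1.
- move=> i j k l e1 e2; apply: Y0 => -[ij kl].
  by move: e1; rewrite -isoE ij kl e2.
Qed.

Lemma perm_vector_objective {R : realType} {n : nat} (sigma : 'S_n) :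
  cplt_objective (perm_vector R sigma *m (perm_vector R sigma)^T) = n%:R.
Proof.
rewrite /cplt_objective (eq_bigr (fun=> 1)) => [|i _].
  by rewrite sumr_const card_ord.
rewrite (bigD1 (sigma i)) //= big1 => [|j /negbTE ji].
  by rewrite addr0 gram_entry big_ord1 !perm_vector_pidx eqxx mulr1.
by rewrite gram_entry big_ord1 !perm_vector_pidx eq_sym ji mulr0.
Qed.

Lemma cptheta_isomorphic {R : realType} {n : nat} {E1 E2 : rel 'I_n} :
  isomorphic E1 E2 -> cptheta R E1 E2 = n%:R%:E.
Proof.
move=> [sigma isoE]; apply/eqP; rewrite eq_le; apply/andP; split.
  by apply: cptheta_le => S; apply: card_partial_isomorphism.
apply: ereal_sup_ubound.
exists (perm_vector R sigma *m (perm_vector R sigma)^T).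
  exact: perm_vector_feasible.
by rewrite perm_vector_objective.
Qed.

Lemma cptheta_not_isomorphic {R : realType} {n : nat} {E1 E2 : rel 'I_n} :
  ~ isomorphic E1 E2 -> (cptheta R E1 E2 < (n%:R - 1 / (4 * n%:R ^+ 4))%:E)%E.
Proof.
(* Empty graphs are isomorphic through the identity, so there is at least one vertex; from here the
   vertex count is [n.+1] and supports have size at most [n]. *)
case: n E1 E2 => [|n] E1 E2 nisoE; first by case: nisoE; exists 1%g => -[].
apply: (@le_lt_trans _ _ n%:R%:E).
  by apply: cptheta_le => S /(card_partial_isomorphism_lt nisoE).
(* What remains is $1/(4(n+1)^4) < 1$. *)
rewrite lte_fin -[n.+1]addn1 natrD ltrBrDl addrC ltrD2l.
rewrite -natrD addn1 -natrX -natrM ltr_pdivrMr ?ltr0n ?muln_gt0 ?expn_gt0 //.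
by rewrite mul1r ltr1n (@leq_trans 4) // leq_pmulr // expn_gt0.
Qed.

Theorem theorem4 (R : realType) (n : nat) (E1 E2 : rel 'I_n)
    (hE1 : simple_graph E1) (hE2 : simple_graph E2) :
  (isomorphic E1 E2 -> cptheta R E1 E2 = (n%:R)%:E) /\
  (~ isomorphic E1 E2 ->
     (cptheta R E1 E2 < (n%:R - 1 / (4 * n%:R ^+ 4))%:E)%E) /\
  (isomorphic E1 E2 <-> cptheta R E1 E2 = (n%:R)%:E).
Proof.
split; first exact: cptheta_isomorphic.
split; first exact: cptheta_not_isomorphic.
split=> [|cpE]; first exact: cptheta_isomorphic.
(* Otherwise $n < n - 1/(4n^4)$, although the subtracted term is non-negative (for $n = 0$ it is 0,
   as division by zero gives 0). *)
apply: contrapT => /(@cptheta_not_isomorphic R).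
by rewrite cpE lte_fin ltrBrDr gtrDl ltNge divr_ge0 ?mulr_ge0 ?exprn_ge0 ?ler0n.
Qed.
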